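(* For any $d\in\mathbb{N}$ and $a\in\mathbb{N}_0$, $$t^{\star}(\{\{2\}^a,3,\{2\}^a,1\}^{d-1},\{2\}^a,3,\{2\}^a)=-\frac{2}{\pi}\sum_{r=1}^{2d}2^r\sum_{\substack{s_1+\cdots+s_r=2d\\ s_1,\ldots,s_r\geq1}}t\big((2a+2)s_1,\ldots,(2a+2)s_r;\,(-1)^{s_1},\ldots,(-1)^{s_{r-1}},(-1)^{s_r-1}\big),$$ where for $r=1$ the inner sum is the single value $t(\overline{2d(2a+2)})$.
   Context: $t^{\star}(\boldsymbol{s})=\sum_{k_1\geq\cdots\geq k_r\geq1}\prod_{j}(2k_j-1)^{-s_j}$ for an index with $s_1>1$; $\{\boldsymbol{u}\}^m$ denotes the sequence $\boldsymbol{u}$ concatenated $m$ times (empty if $m=0$). Alternating multiple $t$-values: for $\boldsymbol{s}\in\mathbb{N}^r$, $\boldsymbol{\sigma}\in\{\pm1\}^r$ with $(s_1,\sigma_1)\ne(1,1)$, $t(\boldsymbol{s};\boldsymbol{\sigma})=\sum_{k_1>\cdots>k_r\geq1}\prod_{j}\frac{\sigma_j^{k_j}}{(2k_j-1)^{s_j}}$; a bar over an argument means its sign is $-1$, so $t(\overline{m})=\sum_{k\ge1}(-1)^k(2k-1)^{-m}$. *)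

(* Defs.v *)
From Stdlib Require Import Reals List Arith.
From Coquelicot Require Import Coquelicot.
Import ListNotations.
Open Scope R_scope.

Definition sum1N (N : nat) (f : nat -> R) : R :=
  fold_right Rplus 0 (map f (seq 1 N)).

Fixpoint tstar_trunc (s : list nat) (N : nat) : R :=
  match s with
  | [] => 1
  | s1 :: rest =>
      sum1N N (fun k => / (INR (2 * k - 1)) ^ s1 * tstar_trunc rest k)
  end.

Definition tstar (s : list nat) : R := real (Lim_seq (tstar_trunc s)).

(* Truncated alternating multiple t-value; each entry is (s_j, sigma_j)
   with sigma_j = 1 or -1:
   sum over N >= k1 > k2 > ... > kr >= 1 of prod_j sigma_j^k_j / (2k_j-1)^s_j. *)
Fixpoint talt_trunc (l : list (nat * R)) (N : nat) : R :=
  match l with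
  | [] => 1
  | (s1, sg1) :: rest =>
      sum1N N (fun k => sg1 ^ k / (INR (2 * k - 1)) ^ s1 * talt_trunc rest (k - 1))
  end.

Definition talt (l : list (nat * R)) : R := real (Lim_seq (talt_trunc l)).

Definition rep {A} (m : nat) (u : list A) : list A := concat (repeat u m).

Fixpoint compositions (n r : nat) : list (list nat) :=
  match r with
  | O => match n with O => [[]] | _ => [] end
  | S r' => flat_map (fun k => map (cons k) (compositions (n - k) r')) (seq 1 n)
  end.

(* Arguments of the t-value in the theorem for a composition s = (s_1..s_r):
   ((2a+2)s_j ; (-1)^{s_j}) for j < r and ((2a+2)s_r ; (-1)^{s_r - 1}). *)
Definition thm_args (a : nat) (s : list nat) : list (nat * R) :=
  map (fun j => let sj := nth j s 0%nat in
                (((2 * a + 2) * sj)%nat,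
                 (-1) ^ (if Nat.eqb j (length s - 1) then (sj + 1)%nat else sj)))
      (seq 0 (length s)).

(* Main.v *)
Require Import Defs.
From Stdlib Require Import Reals List Arith Lra Lia.
From Coquelicot Require Import Coquelicot.
Import ListNotations.
Open Scope R_scope.

(* Write x_k = 2k - 1 and (P f)(k) = f(k) + 2 sum_(j<k) f(j).  Every truncated
   star value occurring here has the form sum_(k<=n) D(n,k) g(k) for the kernel
   D = dker below, and prepending an entry to the index acts on g alone:
     2 : g |-> g / x^2,   1 : g |-> P(g) / x,
     3 : g |-> (-1)^k / x^2 * P((-1)^k g / x),
   while the empty index has g = 4 (-1)^(k-1) / x.  For the index of the theorem
   this makes g the 2d-fold alternating nested sum [chain], in which P weights
   k_i > k_(i+1) by 2 and k_i = k_(i+1) by 1; collecting equal summation indices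
   gives the sum over compositions with the factors 2^r.  Finally D(n,k) tends
   to 1/PI boundedly: the identity sum_k D(n,k) (-1)^(k-1) / x_k = 1/4 becomes
   Leibniz' series in the limit. *)

(** * Finite sums over 1, ..., N *)

Lemma sum1N_0 f : sum1N 0 f = 0.
Proof. reflexivity. Qed.

Lemma sum1N_S N f : sum1N (S N) f = sum1N N f + f (S N).
Proof.
  unfold sum1N. rewrite seq_S, map_app, fold_right_app. simpl.
  rewrite Rplus_0_r. generalize (f (S N)) as c. intros c.
  induction (map f (seq 1 N)) as [|b l IH]; simpl; [ring|rewrite IH; ring].
Qed.

Lemma sum1N_Sl N f : sum1N (S N) f = f 1%nat + sum1N N (fun k => f (S k)).
Proof.
  unfold sum1N. simpl. now rewrite <- (seq_shift N 1), map_map.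
Qed.

Lemma sum1N_ext N f g :
  (forall k, (1 <= k <= N)%nat -> f k = g k) -> sum1N N f = sum1N N g.
Proof.
  induction N as [|N IH]; intros H; [reflexivity|].
  rewrite !sum1N_S, IH, H; auto with arith; intros; apply H; lia.
Qed.

Lemma sum1N_scal N c f : sum1N N (fun k => c * f k) = c * sum1N N f.
Proof.
  induction N as [|N IH]; [unfold sum1N; simpl; ring|].
  rewrite !sum1N_S, IH; ring.
Qed.

Lemma sum1N_plus N f g : sum1N N (fun k => f k + g k) = sum1N N f + sum1N N g.
Proof.
  induction N as [|N IH]; [unfold sum1N; simpl; ring|].
  rewrite !sum1N_S, IH; ring.
Qed.

Lemma sum1N_swap N M (f : nat -> nat -> R) :
  sum1N N (fun i => sum1N M (fun j => f i j)) =
  sum1N M (fun j => sum1N N (fun i => f i j)).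
Proof.
  induction N as [|N IH].
  - induction M as [|M IH]; [reflexivity|].
    rewrite sum1N_S, <- IH. unfold sum1N; simpl; ring.
  - rewrite sum1N_S, IH, <- sum1N_plus. apply sum1N_ext; intros.
    now rewrite sum1N_S.
Qed.

Lemma sum1N_lim N (f : nat -> nat -> R) (l : nat -> R) :
  (forall k, (1 <= k <= N)%nat -> is_lim_seq (fun n => f n k) (l k)) ->
  is_lim_seq (fun n => sum1N N (f n)) (sum1N N l).
Proof.
  induction N as [|N IH]; intros H; [apply is_lim_seq_const|].
  rewrite sum1N_S.
  apply is_lim_seq_ext with (fun n => sum1N N (f n) + f n (S N)).
  { intros; now rewrite sum1N_S. }
  apply is_lim_seq_plus'; [apply IH; intros; apply H|apply H]; lia.
Qed.

(** * The odd numbers x_k and the operator P *)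

Definition oddR (k : nat) : R := INR (2 * k - 1).

Lemma oddR_S k : oddR (S k) = 2 * INR k + 1.
Proof.
  unfold oddR. replace (2 * S k - 1)%nat with (2 * k + 1)%nat by lia.
  rewrite plus_INR, mult_INR; simpl; ring.
Qed.

Lemma oddR_ge1 k : (1 <= k)%nat -> 1 <= oddR k.
Proof.
  intros H; destruct k as [|k]; [lia|]. rewrite oddR_S.
  pose proof (pos_INR k); lra.
Qed.

(** This is the operator P; its weights 1 and 2 later become the factors 2^r. *)
Definition psum (f : nat -> R) (k : nat) : R := f k + 2 * sum1N (k - 1) f.

Lemma psum_S f k : psum f (S k) = f (S k) + 2 * sum1N k f.
Proof. unfold psum. now replace (S k - 1)%nat with k by lia. Qed.

Lemma psum_ext f g k :
  (1 <= k)%nat -> (forall j, (1 <= j <= k)%nat -> f j = g j) -> psum f k = psum g k.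
Proof.
  intros Hk H. unfold psum. rewrite H by lia. f_equal; f_equal.
  apply sum1N_ext; intros; apply H; lia.
Qed.

Lemma psum_scal c f k : psum (fun j => c * f j) k = c * psum f k.
Proof. unfold psum; rewrite sum1N_scal; ring. Qed.

(** * The kernel D: recurrences, positivity and summation identities *)

Fixpoint dker_lead (n : nat) : R :=
  match n with
  | O => 0
  | S O => / 4
  | S m => dker_lead m * ((2 * INR m + 1) ^ 2 / (4 * INR m * (INR m + 1)))
  end.

(* In closed form dker n k = ((2n-1)!!)^2 / (4^n (n-k)! (n+k-1)!) for
   1 <= k <= n, and it vanishes for k > n because of the factor n - n. *)
Fixpoint dker (n k : nat) : R :=
  match k with
  | O => 0
  | S O => dker_lead n
  | S j => dker n j * ((INR n - INR j) / (INR n + INR j))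
  end.

Lemma dker_lead_SS n :
  dker_lead (S (S n)) =
  dker_lead (S n) * ((2 * INR (S n) + 1) ^ 2 / (4 * INR (S n) * (INR (S n) + 1))).
Proof. reflexivity. Qed.

Lemma dker_SS n k :
  dker n (S (S k)) =
  dker n (S k) * ((INR n - INR (S k)) / (INR n + INR (S k))).
Proof. reflexivity. Qed.

Lemma dker_step_k n k :
  (1 <= k)%nat ->
  (INR n + INR k) * dker n (S k) = (INR n - INR k) * dker n k.
Proof.
  intros Hk; destruct k as [|k]; [lia|]. rewrite dker_SS.
  pose proof (pos_INR n). pose proof (pos_INR k). rewrite S_INR in *.
  field. lra.
Qed.

Lemma dker_0 k : dker 0 k = 0.
Proof.
  induction k as [|[|k] IH]; try reflexivity. rewrite dker_SS, IH; ring.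
Qed.

Lemma dker_gt n k : (n < k)%nat -> dker n k = 0.
Proof.
  intros H; induction H as [|k H IH].
  - destruct n as [|n]; [reflexivity|]. rewrite dker_SS. unfold Rminus, Rdiv.
    rewrite Rplus_opp_r; ring.
  - destruct k as [|k]; [lia|]. rewrite dker_SS, IH; ring.
Qed.

(** Here x_(n+1)^2 - x_k^2 = 4 (n+1-k) (n+k), and (n+1-k) (n+k) is the factor gained by the
    factorials in the closed form. At k = n+1 both sides vanish. *)
Lemma dker_step_n n k :
  (1 <= k)%nat ->
  dker (S n) k * (oddR (S n) ^ 2 - oddR k ^ 2) = oddR (S n) ^ 2 * dker n k.
Proof.
  intros Hk; induction Hk as [|k Hk IH].
  - change (dker_lead (S n) * (oddR (S n) ^ 2 - oddR 1 ^ 2) = oddR (S n) ^ 2 * dker_lead n).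
    rewrite !oddR_S. destruct n as [|n].
    + simpl; ring.
    + rewrite dker_lead_SS. pose proof (pos_INR n). rewrite S_INR.
      simpl INR. field. lra.
  - destruct k as [|k]; [lia|].
    rewrite !dker_SS. rewrite !oddR_S in *.
    pose proof (pos_INR n). pose proof (pos_INR k).
    rewrite !S_INR in *. set (X := dker n (S k)) in *. set (Y := dker (S n) (S k)) in *.
    replace ((2 * INR n + 1) ^ 2 *
      (X * ((INR n - (INR k + 1)) / (INR n + (INR k + 1))))) with
      (((2 * INR n + 1) ^ 2 * X) * ((INR n - (INR k + 1)) / (INR n + (INR k + 1)))) by ring.
    rewrite <- IH. field. lra.
Qed.

Lemma dker_pos n k : 0 <= dker n k.
Proof.
  assert (H1 : forall n, 0 <= dker_lead n).
  { clear; induction n as [|[|n] IH]; [simpl; lra|simpl; lra|].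
    rewrite dker_lead_SS. pose proof (pos_INR n). rewrite S_INR.
    apply Rmult_le_pos; [exact IH|].
    apply Rdiv_le_0_compat; [apply pow2_ge_0|nra]. }
  induction k as [|[|k] IH]; [simpl; lra|apply H1|].
  destruct (le_lt_dec (S (S k)) n) as [H|H]; [|rewrite dker_gt; [lra|lia]].
  rewrite dker_SS. apply Rmult_le_pos; [exact IH|].
  apply le_INR in H. pose proof (pos_INR k). rewrite !S_INR in *.
  apply Rdiv_le_0_compat; lra.
Qed.

Lemma dker_decr n k : (1 <= k)%nat -> dker n (S k) <= dker n k.
Proof.
  intros Hk. pose proof (dker_step_k n k Hk). pose proof (dker_pos n k).
  pose proof (dker_pos n (S k)). apply le_INR in Hk. simpl in Hk.
  pose proof (pos_INR n). nra.
Qed.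

Lemma dker_le_lead n k : dker n k <= dker n 1.
Proof.
  induction k as [|[|k] IH]; [apply dker_pos|lra|].
  eapply Rle_trans; [apply dker_decr; lia|exact IH].
Qed.

(** By [dker_step_n], D(m,k) / x_m^2 = (D(m,k) - D(m-1,k)) / x_k^2, so summing over m telescopes.
    The exponent s is left free because the entries 1 and 3 also take this form once a factor x_m is
    moved into or out of the kernel sum. *)
Lemma dker_sum_step n s F h :
  (forall m, (1 <= m)%nat ->
     / oddR m ^ s * F m = / oddR m ^ 2 * sum1N m (fun k => dker m k * h k)) ->
  sum1N n (fun m => / oddR m ^ s * F m) =
  sum1N n (fun k => dker n k * (h k / oddR k ^ 2)).
Proof.
  intros H; induction n as [|n IH]; [reflexivity|].
  rewrite sum1N_S, IH, H by lia.
  (* The added term is zero because D(n,n+1) = 0; it gives all sums the same range. *)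
  replace (sum1N n (fun k => dker n k * (h k / oddR k ^ 2))) with
    (sum1N (S n) (fun k => dker n k * (h k / oddR k ^ 2)))
    by (rewrite sum1N_S, dker_gt by lia; ring).
  rewrite <- sum1N_scal, <- sum1N_plus. apply sum1N_ext; intros k Hk.
  pose proof (dker_step_n n k ltac:(lia)) as E.
  pose proof (oddR_ge1 k ltac:(lia)). pose proof (oddR_ge1 (S n) ltac:(lia)).
  replace (dker n k) with
    (dker (S n) k * (oddR (S n) ^ 2 - oddR k ^ 2) / oddR (S n) ^ 2)
    by (rewrite E; field; lra).
  field. lra.
Qed.

(** Put E_k = (n-k) D(n,k) = (n+k) D(n,k+1). Then x_k D(n,k) = E_(k-1) - E_k for k >= 2, so the
    terms with k > j add up to E_j. The coefficient of g(j) on the left is therefore x_j D(n,j) + 2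
    E_j = x_n D(n,j). *)
Lemma dker_psum_odd n g :
  sum1N n (fun k => dker n k * (oddR k * psum g k)) =
  oddR n * sum1N n (fun k => dker n k * g k).
Proof.
  destruct n as [|n]; [unfold sum1N; simpl; ring|].
  (* Stopping at K leaves a remainder with the factor n - K, which disappears at K = n. *)
  assert (H : forall K,
    sum1N (S K) (fun k => dker (S n) k * (oddR k * psum g k)) =
    oddR (S n) * sum1N (S K) (fun k => dker (S n) k * g k)
    - 2 * ((INR (S n) - INR (S K)) * dker (S n) (S K)) * sum1N (S K) g).
  { induction K as [|K IH].
    - rewrite !sum1N_S, psum_S, !sum1N_0, !oddR_S, !S_INR. simpl INR. ring.
    - rewrite sum1N_S, IH, psum_S, (sum1N_S (S K)), (sum1N_S (S K) g).
      rewrite <- (dker_step_k (S n) (S K)) by lia.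
      rewrite !oddR_S, !S_INR. ring. }
  rewrite H. ring.
Qed.

Definition sgn (k : nat) : R := (-1) ^ k.

Lemma sgn_sqr k : sgn k * sgn k = 1.
Proof.
  unfold sgn. rewrite <- pow_add. replace (k + k)%nat with (2 * k)%nat by lia.
  apply pow_1_even.
Qed.

Lemma sgn_S k : sgn (S k) = - sgn k.
Proof. unfold sgn. simpl. ring. Qed.

(** The signed companion: with the same E_k, x_n D(n,k) = E_(k-1) + E_k for k >= 2, so the signed
    tail beyond j is -(-1)^j E_j, and x_n D(n,j) - 2 E_j = x_j D(n,j). *)
Lemma dker_psum_alt n g :
  oddR n * sum1N n (fun k => dker n k * (sgn k * psum g k)) =
  sum1N n (fun k => dker n k * (sgn k * oddR k * g k)).
Proof.
  destruct n as [|n]; [unfold sum1N; simpl; ring|].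
  assert (H : forall K,
    oddR (S n) * sum1N (S K) (fun k => dker (S n) k * (sgn k * psum g k)) =
    sum1N (S K) (fun k => dker (S n) k * (sgn k * oddR k * g k))
    + 2 * ((INR (S n) - INR (S K)) * dker (S n) (S K)) * sgn (S K) * sum1N (S K) g).
  { induction K as [|K IH].
    - rewrite !sum1N_S, psum_S, !sum1N_0, !oddR_S, !S_INR. simpl INR. ring.
    - rewrite sum1N_S, Rmult_plus_distr_l, IH, psum_S, (sum1N_S (S K)), (sum1N_S (S K) g).
      rewrite <- (dker_step_k (S n) (S K)) by lia.
      rewrite !oddR_S, !sgn_S, !S_INR. ring. }
  rewrite H. ring.
Qed.

(** With N = n+2, the partial sums have a closed form with the factor N - K and the divisor N - 1.
    For N = 1 the sum would be -1/4, hence the start at 2. *)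
Lemma dker_alt_odd_sum n :
  sum1N (S (S n)) (fun k => dker (S (S n)) k * (sgn k * oddR k)) = 0.
Proof.
  assert (H : forall K,
    sum1N (S K) (fun k => dker (S (S n)) k * (sgn k * oddR k)) =
    sgn (S K) * dker (S (S n)) (S K) * INR (S K)
      * (INR (S (S n)) - INR (S K)) / INR (S n)).
  { pose proof (pos_INR n). induction K as [|K IH].
    - rewrite sum1N_S, sum1N_0, oddR_S, !S_INR. simpl INR.
      field. lra.
    - rewrite sum1N_S, IH.
      replace (sgn (S K) * dker (S (S n)) (S K) * INR (S K)
        * (INR (S (S n)) - INR (S K)) / INR (S n)) with
        (sgn (S K) * INR (S K) / INR (S n) *
         ((INR (S (S n)) - INR (S K)) * dker (S (S n)) (S K)))
        by (rewrite !S_INR; field; lra).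
      rewrite <- dker_step_k by lia.
      rewrite oddR_S, !sgn_S, !S_INR. field. lra. }
  rewrite H. unfold Rminus. rewrite Rplus_opp_r. unfold Rdiv. ring.
Qed.

(** The sum does not depend on n: by [dker_step_n], consecutive values differ by a multiple of the
    vanishing sum in [dker_alt_odd_sum]. The value is read off at n = 0, where only D(1,1) = 1/4
    enters. *)
Lemma dker_unit n :
  sum1N (S n) (fun k => dker (S n) k * (sgn k / oddR k)) = - / 4.
Proof.
  induction n as [|n IH].
  - unfold sum1N; simpl. rewrite oddR_S. unfold sgn; simpl. field.
  - rewrite <- IH.
    replace (sum1N (S n) (fun k => dker (S n) k * (sgn k / oddR k))) with
      (sum1N (S (S n)) (fun k => dker (S n) k * (sgn k / oddR k)))
      by (rewrite sum1N_S, (dker_gt (S n) (S (S n))) by lia; ring).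
    apply Rminus_diag_uniq.
    transitivity (/ oddR (S (S n)) ^ 2 *
      sum1N (S (S n)) (fun k => dker (S (S n)) k * (sgn k * oddR k)));
      [|rewrite dker_alt_odd_sum; ring].
    rewrite <- sum1N_scal. match goal with |- ?A - ?B = _ => replace (A - B) with (A + -1 * B) by ring end.
    rewrite <- (sum1N_scal _ (-1)), <- sum1N_plus.
    apply sum1N_ext; intros k Hk.
    pose proof (dker_step_n (S n) k ltac:(lia)) as E.
    pose proof (oddR_ge1 k ltac:(lia)). pose proof (oddR_ge1 (S (S n)) ltac:(lia)).
    replace (dker (S n) k) with
      (dker (S (S n)) k * (oddR (S (S n)) ^ 2 - oddR k ^ 2) / oddR (S (S n)) ^ 2)
      by (rewrite E; field; lra).
    field. lra.
Qed.

(** * Kernel representation of truncated star values *)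

Definition dker_rep (s : list nat) (g : nat -> R) : Prop :=
  forall n, (1 <= n)%nat -> tstar_trunc s n = sum1N n (fun k => dker n k * g k).

Lemma dker_rep_ext s g h :
  (forall k, (1 <= k)%nat -> g k = h k) -> dker_rep s g -> dker_rep s h.
Proof.
  intros E H n Hn. rewrite H by easy. apply sum1N_ext; intros k Hk.
  now rewrite E by lia.
Qed.

(** A rescaling of [dker_unit]. At n = 0 the two sides would be 1 and 0, whence the restriction in
    [dker_rep]. *)
Lemma dker_rep_nil : dker_rep [] (fun k => -4 * (sgn k / oddR k)).
Proof.
  intros [|n] Hn; [lia|].
  transitivity (-4 * sum1N (S n) (fun k => dker (S n) k * (sgn k / oddR k))).
  - rewrite dker_unit. simpl; field.
  - rewrite <- sum1N_scal. apply sum1N_ext; intros; ring.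
Qed.

Lemma dker_rep_2 s g : dker_rep s g -> dker_rep (2%nat :: s) (fun k => g k / oddR k ^ 2).
Proof.
  intros H n Hn. apply (dker_sum_step n 2 (tstar_trunc s)).
  intros m Hm. now rewrite H.
Qed.

Lemma dker_rep_1 s g : dker_rep s g -> dker_rep (1%nat :: s) (fun k => psum g k / oddR k).
Proof.
  intros H n Hn.
  transitivity (sum1N n (fun k => dker n k * (oddR k * psum g k / oddR k ^ 2))).
  - apply (dker_sum_step n 1 (tstar_trunc s)). intros m Hm.
    rewrite dker_psum_odd, H by easy. pose proof (oddR_ge1 m Hm). field. lra.
  - apply sum1N_ext; intros k Hk. pose proof (oddR_ge1 k ltac:(lia)). field. lra.
Qed.

(** Applied to (-1)^j g(j) / x_j, [dker_psum_alt] returns the kernel sum of g, since the signs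
    square to 1. The factor x_m it carries lowers the exponent 3 to 2. *)
Lemma dker_rep_3 s g :
  dker_rep s g ->
  dker_rep (3%nat :: s)
    (fun k => sgn k * psum (fun j => sgn j * g j / oddR j) k / oddR k ^ 2).
Proof.
  intros H n Hn. apply (dker_sum_step n 3 (tstar_trunc s)). intros m Hm.
  pose proof (oddR_ge1 m Hm).
  replace (tstar_trunc s m) with
    (oddR m * sum1N m (fun k => dker m k * (sgn k * psum (fun j => sgn j * g j / oddR j) k))).
  - field. lra.
  - rewrite dker_psum_alt, H by easy. apply sum1N_ext; intros k Hk.
    pose proof (oddR_ge1 k ltac:(lia)).
    replace (sgn k * oddR k * (sgn k * g k / oddR k)) with (sgn k * sgn k * g k)
      by (field; lra).
    rewrite sgn_sqr; ring.
Qed.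

Lemma dker_rep_2s a s g :
  dker_rep s g -> dker_rep (rep a [2%nat] ++ s) (fun k => g k / oddR k ^ (2 * a)).
Proof.
  intros H. induction a as [|a IH].
  - eapply dker_rep_ext; [|exact H]. intros; simpl; field.
  - eapply dker_rep_ext; [|apply (dker_rep_2 _ _ IH)].
    intros k Hk. pose proof (oddR_ge1 k Hk).
    replace (2 * S a)%nat with (2 * a + 2)%nat by lia.
    rewrite pow_add. simpl. field. repeat split; first [lra | apply pow_nonzero; lra].
Qed.

(** * The index of the theorem as a nested sum *)

Definition wt (a k : nat) : R := / oddR k ^ (2 * a + 2).

(* chain a m k is the sum over k = k_1 >= ... >= k_(m+1) >= 1 of the products
   of wt a k_i, all but the last signed by (-1)^k_i, where each strict
   inequality counts twice. *)
Fixpoint chain (a m : nat) : nat -> R :=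
  match m with
  | O => wt a
  | S m => fun k => sgn k * wt a k * psum (chain a m) k
  end.

Lemma chain_S a m k : chain a (S m) k = sgn k * wt a k * psum (chain a m) k.
Proof. reflexivity. Qed.

Lemma wt_split a k : (1 <= k)%nat -> wt a k = / oddR k ^ 2 / oddR k ^ (2 * a).
Proof.
  intros Hk. pose proof (oddR_ge1 k Hk). unfold wt. rewrite pow_add. field.
  repeat split; first [lra | apply pow_nonzero; lra].
Qed.

(** The shape f / x covers both continuations of a block: f is (-1)^k for the empty index and P(g)
    when an entry 1 follows. *)
Lemma dker_rep_step a s f :
  dker_rep s (fun k => -4 * (f k / oddR k)) ->
  dker_rep (rep a [2%nat] ++ [3%nat] ++ rep a [2%nat] ++ s)
    (fun k => -4 * (sgn k * wt a k * psum (fun j => sgn j * wt a j * f j) k)).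
Proof.
  intros H. eapply dker_rep_ext;
    [|apply dker_rep_2s, (dker_rep_3 _ _ (dker_rep_2s a _ _ H))].
  intros k Hk; cbv beta.
  rewrite (psum_ext _ (fun j => -4 * (sgn j * wt a j * f j))).
  - rewrite psum_scal, (wt_split a k Hk). pose proof (oddR_ge1 k Hk). field.
    repeat split; first [lra | apply pow_nonzero; lra].
  - easy.
  - intros j Hj. rewrite (wt_split a j) by lia.
    pose proof (oddR_ge1 j ltac:(lia)). field. repeat split; first [lra | apply pow_nonzero; lra].
Qed.

Lemma rep_S {A} m (u : list A) : rep (S m) u = u ++ rep m u.
Proof. reflexivity. Qed.

(** Each 3 with its surrounding 2s adds two levels to [chain], except that the last one starts from
    the empty index and produces [chain a 1]. Here d counts the blocks containing a 1, one fewer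
    than in the theorem. *)
Lemma dker_rep_main a d :
  dker_rep (rep d (rep a [2%nat] ++ [3%nat] ++ rep a [2%nat] ++ [1%nat])
         ++ (rep a [2%nat] ++ [3%nat] ++ rep a [2%nat]))
    (fun k => -4 * chain a (2 * d + 1) k).
Proof.
  induction d as [|d IH].
  - change (dker_rep (rep a [2%nat] ++ [3%nat] ++ rep a [2%nat])
      (fun k => -4 * chain a 1 k)).
    rewrite <- (app_nil_r (rep a [2%nat])) at 2.
    eapply dker_rep_ext; [|apply (dker_rep_step a [] sgn dker_rep_nil)].
    intros k Hk. simpl. do 2 f_equal. apply psum_ext; [easy|].
    (* The sign of the empty index cancels that of the innermost factor, so the last factor of
       [chain] is unsigned. *)
    intros j _. replace (sgn j * wt a j * sgn j) with (sgn j * sgn j * wt a j) by ring.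
    rewrite sgn_sqr; ring.
  - rewrite rep_S, <- !app_assoc.
    eapply dker_rep_ext; [|apply (dker_rep_step a _ (psum (chain a (2 * d + 1))))].
    + intros k Hk. replace (2 * S d + 1)%nat with (S (S (2 * d + 1))) by lia.
      rewrite chain_S. reflexivity.
    + eapply dker_rep_ext; [|apply (dker_rep_1 _ _ IH)].
      intros k Hk; cbv beta. rewrite psum_scal. unfold Rdiv; ring.
Qed.

(** * Dominated sums and exchange of limits *)

Definition dominated (f : nat -> R) (C : R) : Prop :=
  forall k, (1 <= k)%nat -> Rabs (f k) <= C / oddR k ^ 2.

Lemma dominated_pos f C : dominated f C -> 0 <= C.
Proof.
  intros H. specialize (H 1%nat ltac:(lia)). pose proof (Rabs_pos (f 1%nat)).
  rewrite oddR_S in H. simpl INR in H.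
  replace (C / (2 * 0 + 1) ^ 2) with C in H by field. lra.
Qed.

(** With t = k - 1, 1 / x_k^2 = 1 / (2t+1)^2 <= (1/4) (1/t - 1/(t+1)), which telescopes. *)
Lemma dominated_tail f C M p :
  dominated f C -> (1 <= M)%nat ->
  Rabs (sum1N (M + p) f - sum1N M f) <= C / 4 * (/ INR M - / INR (M + p)).
Proof.
  intros H HM. pose proof (dominated_pos _ _ H) as HC.
  induction p as [|p IH].
  - rewrite Nat.add_0_r. unfold Rminus. rewrite !Rplus_opp_r, Rabs_R0. lra.
  - rewrite Nat.add_succ_r, sum1N_S.
    replace (sum1N (M + p) f + f (S (M + p)) - sum1N M f) with
      ((sum1N (M + p) f - sum1N M f) + f (S (M + p))) by ring.
    eapply Rle_trans; [apply Rabs_triang|].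
    specialize (H (S (M + p)) ltac:(lia)). rewrite oddR_S in H.
    assert (1 <= INR (M + p)) by (apply (le_INR 1); lia).
    assert (C / (2 * INR (M + p) + 1) ^ 2 <=
            C / 4 * (/ INR (M + p) - / INR (S (M + p)))).
    { rewrite S_INR. set (t := INR (M + p)) in *.
      replace (C / 4 * (/ t - / (t + 1))) with (C / (4 * t * (t + 1))) by (field; lra).
      apply Rmult_le_compat_l; [exact HC|]. apply Rinv_le_contravar; nra. }
    lra.
Qed.

Lemma dominated_tail_le f C M N :
  dominated f C -> (1 <= M <= N)%nat ->
  Rabs (sum1N N f - sum1N M f) <= C / 4 / INR M.
Proof.
  intros H HM. replace N with (M + (N - M))%nat by lia.
  eapply Rle_trans; [apply dominated_tail; [exact H|lia]|].
  assert (1 <= INR (M + (N - M))) by (apply (le_INR 1); lia).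
  pose proof (dominated_pos _ _ H).
  assert (0 < / INR (M + (N - M))) by (apply Rinv_0_lt_compat; lra).
  unfold Rdiv at 2. apply Rmult_le_compat_l; lra.
Qed.

Lemma dominated_sum_le f C N : dominated f C -> Rabs (sum1N N f) <= 2 * C.
Proof.
  intros H. pose proof (dominated_pos _ _ H) as HC. destruct N as [|N].
  - rewrite sum1N_0, Rabs_R0; lra.
  - pose proof (dominated_tail_le f C 1 (S N) H ltac:(lia)) as H1.
    specialize (H 1%nat ltac:(lia)).
    rewrite oddR_S in H. simpl INR in *.
    replace (C / (2 * 0 + 1) ^ 2) with C in H by field.
    rewrite (sum1N_S 0), sum1N_0 in H1.
    replace (sum1N (S N) f) with
      ((sum1N (S N) f - (0 + f 1%nat)) + f 1%nat) by ring.
    eapply Rle_trans; [apply Rabs_triang|]. lra.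
Qed.

Lemma dominated_cv f C : dominated f C -> ex_finite_lim_seq (fun N => sum1N N f).
Proof.
  intros H. pose proof (dominated_pos _ _ H) as HC.
  apply ex_lim_seq_cauchy_corr. intros eps.
  destruct (nfloor_ex (C / eps)) as [M HM].
  { apply Rdiv_le_0_compat; [exact HC|apply cond_pos]. }
  exists (S M). intros n m Hn Hm.
  pose proof (dominated_tail_le f C (S M) n H ltac:(lia)) as H1.
  pose proof (dominated_tail_le f C (S M) m H ltac:(lia)) as H2.
  assert (C / 4 / INR (S M) < eps / 2).
  { rewrite S_INR. destruct HM as [_ HM]. pose proof (pos_INR M).
    pose proof (cond_pos eps).
    apply Rlt_div_l; [lra|]. apply Rlt_div_l in HM; [|lra]. nra. }
  replace (sum1N n f - sum1N m f) with
    ((sum1N n f - sum1N (S M) f) - (sum1N m f - sum1N (S M) f)) by ring.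
  eapply Rle_lt_trans; [apply Rabs_triang|]. rewrite Rabs_Ropp. lra.
Qed.

(* Tannery's theorem, for a limit kernel equal to 0. *)
Lemma dominated_weights_to_0 (w : nat -> nat -> R) B g C :
  (forall n k, Rabs (w n k) <= B) ->
  (forall k, (1 <= k)%nat -> is_lim_seq (fun n => w n k) 0) ->
  dominated g C ->
  is_lim_seq (fun n => sum1N n (fun k => w n k * g k)) 0.
Proof.
  intros Hw Hl Hg. pose proof (dominated_pos _ _ Hg) as HC.
  assert (HB : 0 <= B) by (eapply Rle_trans; [apply Rabs_pos|apply (Hw 0%nat 0%nat)]).
  assert (Hd : forall n, dominated (fun k => w n k * g k) (B * C)).
  { intros n k Hk. rewrite Rabs_mult. unfold Rdiv. rewrite Rmult_assoc.
    apply Rmult_le_compat; auto using Rabs_pos. }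
  apply is_lim_seq_spec. intros eps.
  destruct (nfloor_ex (B * C / eps)) as [M HM].
  { apply Rdiv_le_0_compat; [nra|apply cond_pos]. }
  assert (HM' : B * C / 4 / INR (S M) < eps / 2).
  { rewrite S_INR. destruct HM as [_ HM]. pose proof (pos_INR M).
    pose proof (cond_pos eps).
    apply Rlt_div_l; [lra|]. apply Rlt_div_l in HM; [|lra]. nra. }
  assert (Hfin : is_lim_seq (fun n => sum1N (S M) (fun k => w n k * g k)) 0).
  { replace 0 with (sum1N (S M) (fun k => 0 * g k))
      by (rewrite sum1N_scal; ring).
    apply sum1N_lim. intros k Hk.
    apply (is_lim_seq_scal_r _ (g k) 0). apply Hl; lia. }
  apply is_lim_seq_spec in Hfin.
  destruct (Hfin (mkposreal (eps / 2) ltac:(pose proof (cond_pos eps); lra))) as [N HN].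
  simpl in HN. exists (Nat.max N (S M)). intros n Hn.
  specialize (HN n ltac:(lia)). rewrite Rminus_0_r in *.
  pose proof (dominated_tail_le _ _ (S M) n (Hd n) ltac:(lia)) as Ht.
  replace (sum1N n (fun k => w n k * g k)) with
    ((sum1N n (fun k => w n k * g k) - sum1N (S M) (fun k => w n k * g k))
     + sum1N (S M) (fun k => w n k * g k)) by ring.
  eapply Rle_lt_trans; [apply Rabs_triang|]. lra.
Qed.

(** * The limit of the kernel *)

Lemma dker_leibniz n N :
  (1 <= n)%nat ->
  sum_f_R0 (tg_alt (fun k => dker n (S k) / oddR (S k))) (S (2 * N)) <= / 4 <=
  sum_f_R0 (tg_alt (fun k => dker n (S k) / oddR (S k))) (2 * N).
Proof.
  (* The terms decrease, vanish from index n on, and sum to 1/4 by [dker_unit]. The bracket holds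
     for every N and n >= 1, so n may tend to infinity before N does. *)
  intros Hn. apply alternated_series_ineq.
  - intros k. pose proof (dker_decr n (S k) ltac:(lia)).
    pose proof (dker_pos n (S (S k))).
    pose proof (oddR_ge1 (S k) ltac:(lia)).
    apply Rmult_le_compat; [easy| |easy|].
    + left; apply Rinv_0_lt_compat. pose proof (oddR_ge1 (S (S k)) ltac:(lia)); lra.
    + apply Rinv_le_contravar; [lra|]. rewrite !oddR_S, S_INR; lra.
  - intros e He. exists n. intros k Hk. rewrite dker_gt by lia.
    unfold Rdist, Rdiv. rewrite Rmult_0_l, Rminus_0_r, Rabs_R0. exact He.
  - intros e He. exists n. intros k Hk.
    assert (E : forall m, sum_f_R0 (tg_alt (fun k => dker n (S k) / oddR (S k))) m =
      - sum1N (S m) (fun k => dker n k * (sgn k / oddR k))).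
    { induction m as [|m IH].
      - rewrite sum1N_S, sum1N_0. unfold tg_alt, sgn. cbn [sum_f_R0 pow].
        unfold Rdiv. ring.
      - rewrite tech5, IH, (sum1N_S (S m)). unfold tg_alt, sgn. simpl pow.
        unfold Rdiv; ring. }
    rewrite E.
    assert (E2 : forall p, sum1N (n + p) (fun k => dker n k * (sgn k / oddR k)) = - / 4).
    { induction p as [|p IH].
      - rewrite Nat.add_0_r. destruct n as [|n]; [lia|]. apply dker_unit.
      - rewrite Nat.add_succ_r, sum1N_S, IH, dker_gt by lia. ring. }
    replace (S k) with (n + (S k - n))%nat by lia. rewrite E2.
    unfold Rdist. replace (- - / 4 - / 4) with 0 by ring. now rewrite Rabs_R0.
Qed.

Lemma dker_bound n k : dker n k <= 1.
Proof.
  destruct n as [|n]; [rewrite dker_0; lra|].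
  eapply Rle_trans; [apply dker_le_lead|].
  (* The first two Leibniz terms give D(n,1) - D(n,2) / 3 <= 1/4, and D(n,2) <= D(n,1) then yields
     D(n,1) <= 3/8. *)
  pose proof (dker_leibniz (S n) 0 ltac:(lia)) as [H _].
  pose proof (dker_le_lead (S n) 2). pose proof (dker_pos (S n) 2).
  unfold tg_alt in H. change (S (2 * 0)) with 1%nat in H.
  rewrite tech5 in H. unfold sum_f_R0 in H. rewrite !oddR_S in H.
  simpl INR in H. simpl pow in H. lra.
Qed.

(** Consecutive columns have ratio (n-k) / (n+k) = 1 - 2k / (n+k), which tends to 1. *)
Lemma dker_lim_of_lead (L : R) k :
  is_lim_seq (fun n => dker n 1) L -> (1 <= k)%nat -> is_lim_seq (fun n => dker n k) L.
Proof.
  intros H Hk; induction Hk as [|k Hk IH]; [exact H|].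
  destruct k as [|k]; [lia|].
  apply is_lim_seq_ext with
    (fun n => dker n (S k) * ((INR n - INR (S k)) / (INR n + INR (S k)))).
  { intros; now rewrite dker_SS. }
  replace (Finite L) with (Finite (L * (1 - 2 * INR (S k) * 0))) by (f_equal; ring).
  apply is_lim_seq_mult'; [exact IH|].
  apply is_lim_seq_ext with (fun n => 1 - 2 * INR (S k) * / (INR n + INR (S k))).
  { intros n. pose proof (pos_INR n). pose proof (pos_INR k). rewrite S_INR.
    field. lra. }
  apply is_lim_seq_minus'; [apply is_lim_seq_const|].
  apply (is_lim_seq_scal_l _ (2 * INR (S k)) 0).
  replace (Finite 0) with (Rbar_inv p_infty) by reflexivity.
  apply is_lim_seq_inv; [|easy].
  apply is_lim_seq_plus with p_infty (INR (S k));
    [apply is_lim_seq_INR|apply is_lim_seq_const|reflexivity].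
Qed.

(** Monotone convergence: [dker_step_n] at k = 1 shows that the column increases. *)
Lemma dker_lead_cv : ex_finite_lim_seq (fun n => dker n 1).
Proof.
  apply ex_finite_lim_seq_incr with 1; [|intros; apply dker_bound].
  intros n. pose proof (dker_step_n n 1 ltac:(lia)) as H.
  pose proof (dker_pos (S n) 1). rewrite !oddR_S in H. simpl (INR 0) in H.
  pose proof (pos_INR n). nra.
Qed.

Lemma dker_lim k : (1 <= k)%nat -> is_lim_seq (fun n => dker n k) (/ PI).
Proof.
  intros Hk. apply dker_lim_of_lead; [|exact Hk].
  destruct dker_lead_cv as [L HL].
  assert (E : L = / PI); [|now rewrite <- E].
  (* For n to infinity, each Leibniz partial sum becomes L times a partial sum of the series for
     PI/4. The bracket around 1/4 then forces L * PI/4 = 1/4 as N tends to infinity. *)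
  assert (Hs : forall m, is_lim_seq
     (fun n => sum_f_R0 (tg_alt (fun k => dker (S n) (S k) / oddR (S k))) m)
     (L * sum_f_R0 (tg_alt PI_tg) m)).
  { assert (Ht : forall j, is_lim_seq
       (fun n => tg_alt (fun k => dker (S n) (S k) / oddR (S k)) j) (L * tg_alt PI_tg j)).
    { intros j. unfold tg_alt, PI_tg.
      replace (Finite (L * ((-1) ^ j * / INR (2 * j + 1)))) with
        (Rbar_mult ((-1) ^ j / oddR (S j)) L).
      2:{ apply (f_equal Finite). unfold oddR. replace (2 * S j - 1)%nat with (2 * j + 1)%nat by lia.
          unfold Rdiv; ring. }
      apply is_lim_seq_ext with (fun n => (-1) ^ j / oddR (S j) * dker (S n) (S j)).
      { intros; unfold Rdiv; ring. }
      apply is_lim_seq_scal_l.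
      apply (is_lim_seq_incr_1 (fun n => dker n (S j))).
      apply dker_lim_of_lead; [exact HL|lia]. }
    induction m as [|m IH]; [apply Ht|].
    rewrite tech5, Rmult_plus_distr_l.
    eapply is_lim_seq_ext; [|apply is_lim_seq_plus'; [apply IH|apply (Ht (S m))]].
    intros; now rewrite tech5. }
  assert (Hc : is_lim_seq (fun N => L * sum_f_R0 (tg_alt PI_tg) N) (L * (PI / 4))).
  { apply (is_lim_seq_scal_l _ L (PI / 4)). apply is_lim_seq_Reals.
    rewrite <- Alt_PI_eq. unfold Alt_PI. destruct exist_PI as [l Hl].
    now replace (4 * l / 4) with l by field. }
  assert (H1 : L * (PI / 4) <= / 4).
  { apply (is_lim_seq_le (fun N => L * sum_f_R0 (tg_alt PI_tg) (S (2 * N))) (fun _ => / 4)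
      (L * (PI / 4)) (/ 4)).
    - intros N. apply (is_lim_seq_le _ (fun _ => / 4) (L * sum_f_R0 (tg_alt PI_tg) (S (2 * N)))
        (/ 4) (fun n => proj1 (dker_leibniz (S n) N ltac:(lia))));
      [apply Hs|apply is_lim_seq_const].
    - apply (is_lim_seq_subseq (fun N => L * sum_f_R0 (tg_alt PI_tg) N) _
        (fun N => S (2 * N))); [|exact Hc].
      apply eventually_subseq; intros; lia.
    - apply is_lim_seq_const. }
  assert (H2 : / 4 <= L * (PI / 4)).
  { apply (is_lim_seq_le (fun _ => / 4) (fun N => L * sum_f_R0 (tg_alt PI_tg) (2 * N))
      (/ 4) (L * (PI / 4))).
    - intros N. apply (is_lim_seq_le (fun _ => / 4) _ (/ 4) (L * sum_f_R0 (tg_alt PI_tg) (2 * N))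
        (fun n => proj2 (dker_leibniz (S n) N ltac:(lia))));
      [apply is_lim_seq_const|apply Hs].
    - apply is_lim_seq_const.
    - apply (is_lim_seq_subseq (fun N => L * sum_f_R0 (tg_alt PI_tg) N) _
        (fun N => (2 * N)%nat)); [|exact Hc].
      apply eventually_subseq; intros; lia. }
  pose proof PI_RGT_0. apply Rmult_eq_reg_r with PI; [|lra].
  rewrite Rinv_l by lra. lra.
Qed.

(** Write D = (D - 1/PI) + 1/PI. The first weight tends to 0 and is bounded by 1, both D and 1/PI
    lying in [0,1], so Tannery's theorem removes it. *)
Lemma dker_sum_lim g C (T : R) :
  dominated g C -> is_lim_seq (fun n => sum1N n g) T ->
  is_lim_seq (fun n => sum1N n (fun k => dker n k * g k)) (T / PI).
Proof.
  intros Hg HT.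
  apply is_lim_seq_ext with
    (fun n => sum1N n (fun k => (dker n k - / PI) * g k) + / PI * sum1N n g).
  { intros n. rewrite <- sum1N_scal, <- sum1N_plus. apply sum1N_ext; intros; ring. }
  replace (Finite (T / PI)) with (Finite (0 + / PI * T))
    by (f_equal; unfold Rdiv; ring).
  apply is_lim_seq_plus'; [|apply (is_lim_seq_scal_l _ (/ PI) T HT)].
  apply dominated_weights_to_0 with 1 C; [| |exact Hg].
  - intros n k. pose proof (dker_pos n k). pose proof (dker_bound n k).
    assert (0 < / PI <= 1).
    { pose proof PI_RGT_0. split; [now apply Rinv_0_lt_compat|].
      rewrite <- Rinv_1. apply Rinv_le_contravar; [lra|].
      pose proof PI2_1. lra. }
    apply Rabs_le; lra.
  - intros k Hk. replace 0 with (/ PI - / PI) by ring.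
    apply is_lim_seq_minus'; [now apply dker_lim|apply is_lim_seq_const].
Qed.

(** * Domination of the nested sums *)

Lemma inv_oddR_pow_le k s : (1 <= k)%nat -> (2 <= s)%nat ->
  0 <= / oddR k ^ s <= / oddR k ^ 2.
Proof.
  intros Hk Hs. pose proof (oddR_ge1 k Hk). split.
  - left. apply Rinv_0_lt_compat, pow_lt; lra.
  - apply Rinv_le_contravar; [apply pow_lt; lra|]. apply Rle_pow; lra || lia.
Qed.

Lemma Rabs_sgn k : Rabs (sgn k) = 1.
Proof. apply pow_1_abs. Qed.

Lemma dominated_chain a m : exists C, dominated (chain a m) C.
Proof.
  assert (Hwt : forall k, (1 <= k)%nat -> Rabs (wt a k) <= / oddR k ^ 2).
  { intros k Hk. pose proof (inv_oddR_pow_le k (2 * a + 2) Hk ltac:(lia)).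
    unfold wt. rewrite Rabs_pos_eq; lra. }
  induction m as [|m [C IH]].
  - exists 1. intros k Hk. simpl chain. unfold Rdiv. rewrite Rmult_1_l. now apply Hwt.
  (* In P, the diagonal term contributes at most C and twice the partial sum at most 4C. *)
  - exists (5 * C). pose proof (dominated_pos _ _ IH) as HC. intros k Hk.
    rewrite chain_S, !Rabs_mult, Rabs_sgn, Rmult_1_l.
    unfold Rdiv. rewrite (Rmult_comm (5 * C)).
    apply Rmult_le_compat; auto using Rabs_pos.
    unfold psum. eapply Rle_trans; [apply Rabs_triang|].
    rewrite Rabs_mult, (Rabs_pos_eq 2) by lra.
    pose proof (dominated_sum_le _ _ (k - 1) IH).
    assert (Rabs (chain a m k) <= C); [|lra].
    eapply Rle_trans; [apply IH, Hk|].
    pose proof (oddR_ge1 k Hk). rewrite <- (Rmult_1_r C) at 2.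
    apply Rmult_le_compat_l; [exact HC|]. rewrite <- Rinv_1.
    apply Rinv_le_contravar; nra.
Qed.

(** * Sums over compositions *)

Definition lsum {A} (l : list A) (f : A -> R) : R := fold_right Rplus 0 (map f l).

Lemma lsum_app {A} (l1 l2 : list A) f : lsum (l1 ++ l2) f = lsum l1 f + lsum l2 f.
Proof.
  unfold lsum. induction l1 as [|x l IH]; simpl; [ring|rewrite IH; ring].
Qed.

Lemma lsum_flat_map {A B} (l : list A) (h : A -> list B) f :
  lsum (flat_map h l) f = lsum l (fun x => lsum (h x) f).
Proof.
  induction l as [|x l IH]; [reflexivity|]. simpl flat_map. rewrite lsum_app, IH.
  reflexivity.
Qed.

Lemma lsum_map {A B} (l : list A) (h : A -> B) f :
  lsum (map h l) f = lsum l (fun x => f (h x)).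
Proof. unfold lsum. now rewrite map_map. Qed.

Lemma lsum_ext {A} (l : list A) f g :
  (forall x, In x l -> f x = g x) -> lsum l f = lsum l g.
Proof. intros H. unfold lsum. f_equal. now apply map_ext_in. Qed.

Lemma lsum_scal {A} (l : list A) c f : lsum l (fun x => c * f x) = c * lsum l f.
Proof.
  unfold lsum. induction l as [|x l IH]; simpl; [ring|rewrite IH; ring].
Qed.

Lemma lsum_sum1N {A} (l : list A) N (f : A -> nat -> R) :
  lsum l (fun x => sum1N N (f x)) = sum1N N (fun n => lsum l (fun x => f x n)).
Proof.
  induction l as [|x l IH].
  - unfold lsum; simpl. rewrite (sum1N_ext _ _ (fun _ => 0 * 0)) by (intros; ring).
    rewrite sum1N_scal; ring.
  - change (sum1N N (f x) + lsum l (fun x => sum1N N (f x)) =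
      sum1N N (fun n => f x n + lsum l (fun x => f x n))).
    rewrite IH, sum1N_plus. reflexivity.
Qed.

Lemma lsum_lim {A} (l : list A) (f : nat -> A -> R) (g : A -> R) :
  (forall x, In x l -> is_lim_seq (fun n => f n x) (g x)) ->
  is_lim_seq (fun n => lsum l (f n)) (lsum l g).
Proof.
  induction l as [|x l IH]; intros H; [apply is_lim_seq_const|].
  apply (is_lim_seq_plus' (fun n => f n x) (fun n => lsum l (f n))).
  - apply H; now left.
  - apply IH; intros; apply H; now right.
Qed.

Lemma compositions_S n r f :
  lsum (compositions n (S r)) f =
  sum1N n (fun k => lsum (compositions (n - k) r) (fun s => f (k :: s))).
Proof.
  simpl compositions. rewrite lsum_flat_map. unfold sum1N.
  apply lsum_ext. intros; apply lsum_map.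
Qed.

Lemma compositions_0_S r : compositions 0 (S r) = [].
Proof. reflexivity. Qed.

Lemma compositions_pos n r s : In s (compositions n r) -> List.Forall (fun k => (1 <= k)%nat) s.
Proof.
  revert n s; induction r as [|r IH]; intros n s H.
  - destruct n; simpl in H; [|easy]. destruct H as [<-|[]]. constructor.
  - simpl in H. apply in_flat_map in H as [k [Hk H]]. apply in_map_iff in H as [u [<- H]].
    apply in_seq in Hk. constructor; [lia|]. now apply IH in H.
Qed.

Lemma compositions_nonempty n r s :
  (1 <= r)%nat -> In s (compositions n r) -> s <> [].
Proof.
  intros Hr H. destruct r as [|r]; [lia|]. simpl in H.
  apply in_flat_map in H as [k [Hk H]]. apply in_map_iff in H as [u [<- H]]. easy.
Qed.

(** The last entry alone has its sign exponent raised by 1; with a nonempty tail it stays the same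
    entry after k is prepended. *)
Lemma thm_args_cons a k s :
  s <> [] -> thm_args a (k :: s) = (((2 * a + 2) * k)%nat, (-1) ^ k) :: thm_args a s.
Proof.
  intros Hs. destruct s as [|k' s]; [easy|]. unfold thm_args.
  change (length (k :: k' :: s)) with (S (S (length s))).
  change (length (k' :: s)) with (S (length s)).
  rewrite <- (cons_seq (S (length s)) 0), <- seq_shift, map_cons, map_map.
  f_equal. apply map_ext. intros j.
  replace (S (S (length s)) - 1)%nat with (S (length s)) by lia.
  now replace (S (length s) - 1)%nat with (length s) by lia.
Qed.

Lemma thm_args_single a k :
  thm_args a [k] = [(((2 * a + 2) * k)%nat, (-1) ^ (k + 1))].
Proof. reflexivity. Qed.

Lemma wt_pow a n k : / oddR n ^ ((2 * a + 2) * k) = wt a n ^ k.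
Proof. unfold wt. now rewrite pow_mult, pow_inv. Qed.

(** Sorting by the length k of the initial run of indices equal to n: the next index is strictly
    smaller and brings the factor 2. The final term is the case where all m+1 indices equal n. *)
Lemma chain_unroll a m n :
  chain a m n =
  sum1N m (fun k => (sgn n * wt a n) ^ k * (2 * sum1N (n - 1) (chain a (m - k))))
  + (sgn n * wt a n) ^ m * wt a n.
Proof.
  induction m as [|m IH].
  - rewrite sum1N_0. simpl. ring.
  - rewrite chain_S, sum1N_Sl. unfold psum. rewrite IH.
    rewrite (sum1N_ext m (fun k => (sgn n * wt a n) ^ S k * _)
      (fun k => (sgn n * wt a n) *
        ((sgn n * wt a n) ^ k * (2 * sum1N (n - 1) (chain a (m - k))))))
      by (intros; simpl; ring).
    rewrite sum1N_scal. replace (S m - 1)%nat with m by lia. simpl pow. ring.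
Qed.

Lemma sgn_pow n k : ((-1) ^ k) ^ n = sgn n ^ k.
Proof. unfold sgn. now rewrite <- !pow_mult, Nat.mul_comm. Qed.

(** The parts of a composition are the multiplicities of the equal indices in [chain]. Its r - 1
    strict drops give 2^(r-1), and the factor 2 on the right completes 2^r. The bound R may exceed m
    because removing a first part k lowers m by k but r only by 1. *)
Lemma talt_composition_sum a m R N :
  (1 <= m <= R)%nat ->
  sum1N R (fun r => 2 ^ r *
    lsum (compositions m r) (fun s => talt_trunc (thm_args a s) N)) =
  2 * sum1N N (chain a (m - 1)).
Proof.
  revert R N. induction m as [m IH] using (well_founded_induction lt_wf).
  intros R N HR. destruct m as [|m]; [lia|]. destruct R as [|R]; [lia|].
  replace (S m - 1)%nat with m by lia.
  rewrite sum1N_Sl.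
  assert (H1 : lsum (compositions (S m) 1) (fun s => talt_trunc (thm_args a s) N) =
    sum1N N (fun n => (sgn n * wt a n) ^ m * wt a n)).
  { rewrite compositions_S, sum1N_S.
    rewrite (sum1N_ext m _ (fun _ => 0 * 0)).
    2:{ intros k Hk. destruct (S m - k)%nat eqn:E; [lia|]. unfold lsum; simpl; ring. }
    rewrite sum1N_scal. replace (S m - S m)%nat with 0%nat by lia.
    change (lsum (compositions 0 0) (fun s => talt_trunc (thm_args a (S m :: s)) N))
      with (talt_trunc (thm_args a [S m]) N + 0).
    rewrite Rmult_0_l, Rplus_0_l, Rplus_0_r.
    rewrite thm_args_single. cbn [talt_trunc]. apply sum1N_ext. intros n Hn.
    fold (oddR n). unfold Rdiv. rewrite wt_pow, sgn_pow.
    (* The extra sign on the last entry leaves m signs for m+1 equal factors, as in [chain]. *)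
    replace (S m + 1)%nat with (m + 2)%nat by lia.
    rewrite pow_add. replace (sgn n ^ 2) with (sgn n * sgn n) by ring.
    rewrite sgn_sqr, Rpow_mult_distr. simpl pow; ring. }
  rewrite H1.
  (* The first part k stops at m, since at least one further part must remain. *)
  assert (H2 : forall r, (1 <= r)%nat ->
    lsum (compositions (S m) (S r)) (fun s => talt_trunc (thm_args a s) N) =
    sum1N m (fun k => sum1N N (fun n => (sgn n * wt a n) ^ k *
      lsum (compositions (S m - k) r) (fun s => talt_trunc (thm_args a s) (n - 1))))).
  { intros r Hr. rewrite compositions_S, sum1N_S.
    replace (S m - S m)%nat with 0%nat by lia.
    destruct r as [|r]; [lia|]. rewrite compositions_0_S.
    unfold lsum at 2; simpl fold_right. rewrite Rplus_0_r.
    apply sum1N_ext. intros k Hk.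
    transitivity (lsum (compositions (S m - k) (S r)) (fun s =>
      sum1N N (fun n => (sgn n * wt a n) ^ k * talt_trunc (thm_args a s) (n - 1)))).
    - apply lsum_ext. intros s Hs.
      rewrite thm_args_cons by (eapply compositions_nonempty; [|exact Hs]; lia).
      cbn [talt_trunc]. apply sum1N_ext. intros n Hn. fold (oddR n).
      unfold Rdiv. now rewrite wt_pow, sgn_pow, Rpow_mult_distr.
    - rewrite lsum_sum1N. apply sum1N_ext. intros. apply lsum_scal. }
  rewrite (sum1N_ext R _ (fun r => 2 * sum1N m (fun k => sum1N N (fun n =>
     (sgn n * wt a n) ^ k * (2 ^ r *
      lsum (compositions (S m - k) r) (fun s => talt_trunc (thm_args a s) (n - 1))))))).
  2:{ intros r Hr. rewrite H2 by lia. simpl pow at 1. rewrite Rmult_assoc. f_equal.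
      rewrite <- sum1N_scal. apply sum1N_ext; intros k Hk.
      rewrite <- sum1N_scal. apply sum1N_ext; intros n Hn. ring. }
  rewrite sum1N_scal, pow_1, <- Rmult_plus_distr_l. f_equal.
  rewrite sum1N_swap.
  rewrite (sum1N_ext m _ (fun k => sum1N N (fun n =>
     (sgn n * wt a n) ^ k * (2 * sum1N (n - 1) (chain a (m - k)))))).
  2:{ intros k Hk. rewrite sum1N_swap. apply sum1N_ext; intros n Hn.
      rewrite sum1N_scal, IH by lia. do 4 f_equal. lia. }
  rewrite sum1N_swap, <- sum1N_plus. apply sum1N_ext; intros n Hn.
  rewrite (chain_unroll a m n). ring.
Qed.

(** * Convergence of the alternating t-values *)

Lemma talt_term_bound s sg C t k :
  (1 <= k)%nat -> (2 <= s)%nat -> Rabs sg <= 1 -> Rabs t <= C ->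
  Rabs (sg ^ k / oddR k ^ s * t) <= C / oddR k ^ 2.
Proof.
  intros Hk Hs Hsg Ht. pose proof (inv_oddR_pow_le k s Hk Hs).
  rewrite Rabs_mult. unfold Rdiv. rewrite (Rmult_comm C).
  apply Rmult_le_compat; auto using Rabs_pos.
  rewrite Rabs_mult, (Rabs_pos_eq (/ _)), <- RPow_abs by lra.
  assert (0 <= Rabs sg ^ k <= 1).
  { split; [apply pow_le, Rabs_pos|]. rewrite <- (pow1 k).
    apply pow_incr. split; [apply Rabs_pos|easy]. }
  nra.
Qed.

Lemma talt_trunc_bound l :
  List.Forall (fun p => (2 <= fst p)%nat /\ Rabs (snd p) <= 1) l ->
  exists C, forall N, Rabs (talt_trunc l N) <= C.
Proof.
  intros H. induction H as [|[s sg] l [Hs Hsg] Hl [C IH]].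
  - exists 1. intros; simpl. rewrite Rabs_R1; lra.
  - exists (2 * C). intros N. apply dominated_sum_le. intros k Hk.
    now apply talt_term_bound.
Qed.

(** Inner truncations are uniformly bounded and the outer exponent is at least 2, so the outer sum
    is dominated and [talt] is a genuine finite limit. *)
Lemma talt_trunc_cv l :
  List.Forall (fun p => (2 <= fst p)%nat /\ Rabs (snd p) <= 1) l ->
  is_lim_seq (talt_trunc l) (talt l).
Proof.
  intros H. apply Lim_seq_correct'.
  destruct H as [|[s sg] l [Hs Hsg] Hl].
  - exists 1. apply is_lim_seq_const.
  - destruct (talt_trunc_bound l Hl) as [C HC].
    apply (dominated_cv (fun k => sg ^ k / oddR k ^ s * talt_trunc l (k - 1)) C).
    intros k Hk. now apply talt_term_bound.
Qed.

Lemma thm_args_summable a s :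
  List.Forall (fun k => (1 <= k)%nat) s ->
  List.Forall (fun p => (2 <= fst p)%nat /\ Rabs (snd p) <= 1) (thm_args a s).
Proof.
  intros H. apply Forall_forall. intros p Hp. unfold thm_args in Hp.
  apply in_map_iff in Hp as [j [<- Hj]]. apply in_seq in Hj. simpl fst; simpl snd. split.
  - rewrite Forall_forall in H. assert (Hn : In (nth j s 0%nat) s) by (apply nth_In; lia).
    specialize (H _ Hn).
    nia.
  - rewrite pow_1_abs. lra.
Qed.

Theorem theorem4p8 (d a : nat) (hd : (1 <= d)%nat) :
  tstar (rep (d - 1) (rep a [2%nat] ++ [3%nat] ++ rep a [2%nat] ++ [1%nat])
         ++ (rep a [2%nat] ++ [3%nat] ++ rep a [2%nat]))
  = - (2 / PI) *
    sum1N (2 * d) (fun r =>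
      2 ^ r * fold_right Rplus 0
        (map (fun s => talt (thm_args a s)) (compositions (2 * d) r))).
Proof.
  destruct (dominated_chain a (2 * d - 1)) as [C HC].
  destruct (dominated_cv _ _ HC) as [T HT].
  assert (HR : sum1N (2 * d) (fun r => 2 ^ r *
      lsum (compositions (2 * d) r) (fun s => talt (thm_args a s))) = 2 * T).
  (* Both sides are limits of the same truncated sums, by [talt_composition_sum] with m = R = 2d. *)
  { assert (H1 : is_lim_seq (fun N => 2 * sum1N N (chain a (2 * d - 1)))
      (sum1N (2 * d) (fun r => 2 ^ r *
        lsum (compositions (2 * d) r) (fun s => talt (thm_args a s))))).
    { eapply is_lim_seq_ext;
        [intros N; apply (talt_composition_sum a (2 * d) (2 * d) N); lia|].
      apply sum1N_lim. intros r Hr.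
      apply (is_lim_seq_scal_l _ (2 ^ r)
        (lsum (compositions (2 * d) r) (fun s => talt (thm_args a s)))).
      apply lsum_lim. intros s Hs.
      apply talt_trunc_cv, thm_args_summable. eapply compositions_pos, Hs. }
    pose proof (is_lim_seq_scal_l _ 2 _ HT) as H2.
    apply is_lim_seq_unique in H1. apply is_lim_seq_unique in H2.
    rewrite H2 in H1. now injection H1. }
  unfold lsum in HR. rewrite HR.
  (* The -4 comes from the empty index and 1/PI from the kernel; -4 T / PI is -(2/PI) times 2T. *)
  unfold tstar. erewrite is_lim_seq_unique with (l := Finite (-4 * T / PI)).
  { simpl. pose proof PI_RGT_0. field. lra. }
  apply is_lim_seq_ext_loc with
    (fun n => sum1N n (fun k => dker n k * (-4 * chain a (2 * d - 1) k))).
  { exists 1%nat. intros n Hn. rewrite (dker_rep_main a (d - 1) n Hn).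
    now replace (2 * (d - 1) + 1)%nat with (2 * d - 1)%nat by lia. }
  apply dker_sum_lim with (4 * C).
  - intros k Hk. rewrite Rabs_mult, Rabs_left by lra.
    specialize (HC k Hk). unfold Rdiv in *. rewrite Rmult_assoc. lra.
  - eapply is_lim_seq_ext; [intros n; symmetry; apply sum1N_scal|].
    apply (is_lim_seq_scal_l _ (-4) _ HT).
Qed.
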